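(* Consider the two-period model $$Y_t=h_t(\alpha+X_t\beta-U_t),\qquad t=1,2,$$ where $\alpha$ is a real random variable, $X_t$ is a random $1\times K$ row vector, $\beta\in\mathbb{R}^K$, $X=(X_1,X_2)$, $Y=(Y_1,Y_2)$, and $F_t(u\mid\alpha,X)$ denotes the conditional CDF of $U_t$ given $(\alpha,X)$. Suppose the joint distribution of $(Y,X)$ is observed and that: (A1) for each $t$, $h_t:\mathbb{R}\to\mathcal{Y}$ is unknown, non-decreasing, right continuous and non-constant; (A2) (i) $F_1(u\mid\alpha,X)=F_2(u\mid\alpha,X)\equiv F(u\mid\alpha,X)$ for all $(\alpha,X)$; (ii) the support of $F(\cdot\mid\alpha,X)$ is $\mathbb{R}$ for all $(\alpha,X)$; (A3) with $\Delta X=X_2-X_1$ and $W=(\Delta X,-1)$: (i) at least one component of $\Delta X$ has, with probability one, a positive Lebesgue density on $\mathbb{R}$ conditional on all the other components of $\Delta X$, and the corresponding component of $\beta$ is non-zero; (ii) the support of $W$ is not contained in any proper linear subspace of $\mathbb{R}^{K+1}$; (A4) for every $(y_1,y_2)\in\underline{\mathcal{Y}}^2$, $(\beta,\,h_2^-(y_2)-h_1^-(y_1))\in\mathcal{B}\times\mathbb{R}$, where $\mathcal{B}=\{\beta\in\mathbb{R}^K:\|\beta\|=1\}$; (5a) $h_1$ and $h_2$ are strictly increasing; (5b) $\mathrm{Cov}[\alpha,U_t\mid X=x]=0$ for all $x\in\mathcal{X}$ and $t=1,2$; (5c) $\mathrm{Cov}[U_1,U_2\mid X=x]=0$ for all $x\in\mathcal{X}$.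 Let $\sigma_\alpha^2(x)=\mathrm{Var}[\alpha\mid X=x]$ for $x\in\mathcal{X}$, fix an arbitrary $y_0\in\underline{\mathcal{Y}}$, and let $c_1=h_1^{-1}(y_0)$ and $g_t(y)=h_t^{-1}(y)-c_1$ for $y\in\underline{\mathcal{Y}}$, $t=1,2$. Then, for all $x\in\mathcal{X}$, the conditional variance function $\sigma_\alpha^2(x)$ is identified and given by $$\sigma_\alpha^2(x)=\mathrm{Cov}\left(g_2(Y_2)-X_2\beta,\;g_1(Y_1)-X_1\beta\mid X=x\right).$$
   Context: The set $\mathcal{Y}\subseteq\mathbb{R}$ is the (known) support of $Y_t$, understood as the set of values $h_t(\mathbb{R})$, the same for $t=1,2$; the support of the latent variable $\alpha+X_t\beta-U_t$ is $\mathbb{R}$. Set $\underline{\mathcal{Y}}=\mathcal{Y}\setminus\{\inf\mathcal{Y}\}$. The generalized inverse of $h_t$ is $h_t^-(y)=\inf\{y^*\in\mathbb{R}: y\le h_t(y^* )\}$, $y\in\mathcal{Y}$ (with the convention $\inf\emptyset=\inf\mathcal{Y}$); when $h_t$ is strictly increasing, $h_t^{-1}$ denotes its inverse on $\mathcal{Y}$. $\mathcal{X}$ denotes the support of $X$. The conditional variances and covariances appearing in the statement are assumed to exist and be finite; statements about conditional moments given $X=x$ are understood for the usual versions (almost everywhere in $x$). $(\alpha,U_1,U_2)$ are unobserved; no restriction is placed on the joint distribution of $(\alpha,X)$ other than those stated. No location normalization is imposed on $h_1$. A structure consists of $(\beta,h_1,h_2)$ together with a joint distribution of $(\alpha,X,U_1,U_2)$.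 A functional of the structure is ''identified'' if any two structures that both satisfy the model and all the stated assumptions and that generate the same joint distribution of $(Y,X)$ give the same value of that functional. *)

(* Defs.v *)
From HB Require Import structures.
From mathcomp Require Import all_boot all_order all_algebra.
From mathcomp Require Import all_classical all_reals all_analysis.
From mathcomp Require Import measurable_realfun.

Set Implicit Arguments.
Unset Strict Implicit.
Unset Printing Implicit Defensive.

Import Order.TTheory GRing.Theory Num.Theory.
Import numFieldNormedType.Exports.

Local Open Scope classical_set_scope.
Local Open Scope ring_scope.

Section probability_notions.
Context {R : realType}.

(* [mu] is any set function on a topological space, so that it can be the
   law [fun V => P (W @^-1` V)] of a map into a space such as 'rV[R]_n,
   which has a topology but no sigma-algebra in the library. *)
Definition supp {T : topologicalType} (mu : set T -> \bar R) : set T :=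
  [set x | forall V : set T, open V -> V x -> (0 < mu V)%E].

(* [kappa] is a (regular) version of the conditional law of [Z] given [V].
   Being indexed by the values of [V], [kappa v] is the law of [Z]
   given [V = v]. *)
Definition is_cond_law {d d1 d2} {T : measurableType d}
    {T1 : measurableType d1} {T2 : measurableType d2} (P : probability T R)
    (V : {mfun T >-> T1}) (Z : T -> T2)
    (kappa : {mfun T1 >-> pprobability T2 R}) : Prop :=
  forall (A : set T1) (B : set T2), measurable A -> measurable B ->
    (P (V @^-1` A `&` Z @^-1` B) =
     \int[distribution P V]_(v in A) (kappa v : probability T2 R) B)%E.

(* The covariance of [A] and [B] exists and is finite. *)
Definition finite_covariance {d} {T : measurableType d} (P : probability T R)
    (A B : T -> R) : Prop :=
  [/\ P.-integrable setT (EFin \o A), P.-integrable setT (EFin \o B)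
    & P.-integrable setT (EFin \o (A \* B))].

End probability_notions.

Section generalized_inverse.
Context {R : realType}.
Implicit Types (Y : set R) (h : R -> R).

(* Y minus its infimum; the latter is taken in the extended reals, so that
   nothing is removed when Y is unbounded below. *)
Definition lower_trim Y : set R :=
  [set y | Y y /\ y%:E <> ereal_inf (EFin @` Y)].

(* inf {s | y <= h s}, with the convention inf set0 = inf Y. *)
Definition ginv Y h (y : R) : \bar R :=
  if `[< [set s | y <= h s] = set0 >] then ereal_inf (EFin @` Y)
  else ereal_inf (EFin @` [set s | y <= h s]).

End generalized_inverse.

Variant period := period1 | period2.

(* Values of X = (X_1, X_2), and of ((alpha, X), (U_1, U_2)).  Random vectors
   of R^K are tuples because the library's product sigma-algebra lives there. *)
Notation covT R K := (K.-tuple R * K.-tuple R)%type.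
Notation latT R K := ((R * covT R K) * (R * R))%type.

Record structure (R : realType) (K : nat) := Structure {
  beta : 'cV[R]_K ;
  h : period -> R -> R ;
  law : probability (latT R K) R }.

Section model.
Context {R : realType} {K : nat}.
Implicit Types (w : latT R K) (t : period).

Definition alphaX w : R * covT R K := w.1.
Definition alpha w : R := w.1.1.
Definition Xs w : covT R K := w.1.2.
Definition X t w : K.-tuple R :=
  match t with period1 => w.1.2.1 | period2 => w.1.2.2 end.
Definition U t w : R :=
  match t with period1 => w.2.1 | period2 => w.2.2 end.

Definition Xbeta (b : 'cV[R]_K) t w : R := \sum_(k < K) tnth (X t w) k * b k 0.

Definition DX w : K.-tuple R :=
  [tuple tnth (X period2 w) k - tnth (X period1 w) k | k < K].

Definition DX_at (k : 'I_K) w : R := tnth (DX w) k.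
Definition DX_others (k : 'I_K) w : (K.-1).-tuple R :=
  [tuple tnth (DX w) (lift k j) | j < K.-1].

(* W = (X_2 - X_1, -1) *)
Definition W w : 'rV[R]_(K + 1) :=
  row_mx (\row_(k < K) tnth (DX w) k) (const_mx (-1)).

Lemma measurable_alphaX : measurable_fun setT alphaX.
Proof. exact: measurable_fst. Qed.
HB.instance Definition _ := isMeasurableFun.Build _ _ _ _ alphaX
  measurable_alphaX.

Lemma measurable_Xs : measurable_fun setT Xs.
Proof.
exact: (measurableT_comp (@measurable_snd _ _ _ _) (@measurable_fst _ _ _ _)).
Qed.
HB.instance Definition _ := isMeasurableFun.Build _ _ _ _ Xs measurable_Xs.

Lemma measurable_X t : measurable_fun setT (X t).
Proof.
case: t.
- exact: (measurableT_comp (@measurable_fst _ _ _ _) measurable_Xs).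
- exact: (measurableT_comp (@measurable_snd _ _ _ _) measurable_Xs).
Qed.

Lemma measurable_DX_others k : measurable_fun setT (DX_others k).
Proof.
apply/measurable_fun_tnthP => j.
rewrite (_ : _ \o _ = fun w => tnth (X period2 w) (lift k j)
                             - tnth (X period1 w) (lift k j)); last first.
  by apply/funext => w /=; rewrite !tnth_mktuple.
by apply: measurable_funB;
  apply: (measurableT_comp (measurable_tnth _) (measurable_X _)).
Qed.
HB.instance Definition _ k := isMeasurableFun.Build _ _ _ _ (DX_others k)
  (measurable_DX_others k).

Definition outcome (S : structure R K) t w : R :=
  h S t (alpha w + Xbeta (beta S) t w - U t w).

Definition observables (S : structure R K) w : (R * R) * covT R K :=
  ((outcome S period1 w, outcome S period2 w), Xs w).

Definition same_observed_law (S S' : structure R K) : Prop :=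
  forall A : set ((R * R) * covT R K), measurable A ->
    law S (observables S @^-1` A) = law S' (observables S' @^-1` A).

Definition link_regular (Y : set R) (S : structure R K) : Prop :=
  forall t, [/\ range (h S t) = Y, {homo h S t : s s' / s <= s'},
    right_continuous (h S t) & exists s s', h S t s <> h S t s'].

(* [F t] is a version of the conditional law of U_t given (alpha, X), and
   [F t ax `]-oo, u]] is F_t(u | alpha, X) at (alpha, X) = ax. *)
Definition stationary_errors (S : structure R K) : Prop :=
  exists F : period -> {mfun (R * covT R K)%type >->
                             pprobability R R},
    [/\ forall t, is_cond_law (law S) alphaX (U t) (F t),
      {ae distribution (law S) alphaX, forall ax, forall u : R,
         (F period1 ax : probability _ _) `]-oo, u]%classic =
         (F period2 ax : probability _ _) `]-oo, u]%classic}
    & {ae distribution (law S) alphaX, forall ax, forall t,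
         supp (F t ax : probability R R) = setT}].

Definition continuous_regressor (S : structure R K) : Prop :=
  exists k : 'I_K, beta S k 0 != 0 /\
    exists kappa : {mfun ((K.-1).-tuple R) >->
                         pprobability R R},
      is_cond_law (law S) (DX_others k) (DX_at k) kappa /\
      {ae distribution (law S) (DX_others k), forall z,
        exists f : R -> R, [/\ measurable_fun setT f, forall r, 0 < f r
          & forall A : set R, measurable A ->
            ((kappa z : probability _ _) A =
             \int[lebesgue_measure]_(r in A) (f r)%:E)%E]}.

Definition no_collinearity (S : structure R K) : Prop :=
  forall V : {vspace 'rV[R]_(K + 1)}, V <> fullv ->
    ~ (supp (fun O => law S (W @^-1` O)) `<=` [set v | v \in V]).

(* Euclidean norm; the library's [`|b|] is the max norm. *)
Definition unit_sphere : set 'cV[R]_K :=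
  [set b | Num.sqrt (\sum_(k < K) b k 0 ^+ 2) = 1].

Definition parameter_space (Y : set R) (S : structure R K) : Prop :=
  forall y1 y2, lower_trim Y y1 -> lower_trim Y y2 ->
    unit_sphere (beta S) /\
    (ginv Y (h S period2) y2 - ginv Y (h S period1) y1)%E \is a fin_num.

(* [P] is a version of the conditional probability given X on the underlying
   space: [P x] is the conditional probability given X = x, and conditional
   moments given X = x are moments under [P x]. *)
Definition is_cond_given_X (S : structure R K)
    (P : {mfun (covT R K) >-> pprobability (latT R K) R}) : Prop :=
  is_cond_law (law S) Xs id P.

Definition cond_variance_alpha
    (P : {mfun (covT R K) >-> pprobability (latT R K) R}) (x : covT R K)
    : \bar R :=
  variance (P x : probability (latT R K) R) alpha.

Record admissible (Y : set R) (S : structure R K)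
    (P : {mfun (covT R K) >-> pprobability (latT R K) R}) : Prop := {
  adm_version : is_cond_given_X S P ;
  adm_link : link_regular Y S ;
  adm_errors : stationary_errors S ;
  adm_continuous : continuous_regressor S ;
  adm_support : no_collinearity S ;
  adm_parameter : parameter_space Y S ;
  adm_strict : forall t, {homo h S t : s s' / s < s'} ;
  adm_finite : {ae distribution (law S) Xs, forall x,
    [/\ finite_covariance (P x) alpha alpha,
        forall t, finite_covariance (P x) alpha (U t)
      & finite_covariance (P x) (U period1) (U period2)]} ;
  adm_cov_alpha_U : {ae distribution (law S) Xs, forall x, forall t,
    covariance (P x) alpha (U t) = 0%E} ;
  adm_cov_U : {ae distribution (law S) Xs, forall x,
    covariance (P x) (U period1) (U period2) = 0%E} }.

(* Used only on Y = range (h S t), with [h S t] injective. *)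
Definition hinv (S : structure R K) t : R -> R := pinv setT (h S t).

Definition g (S : structure R K) (y0 : R) t (y : R) : R :=
  hinv S t y - hinv S period1 y0.

Definition residual (S : structure R K) (y0 : R) t w : R :=
  g S y0 t (outcome S t w) - Xbeta (beta S) t w.

End model.

(* Main.v *)
Require Import Defs.
From HB Require Import structures.
From mathcomp Require Import all_boot all_order all_algebra.
From mathcomp Require Import all_classical all_reals all_analysis.
From mathcomp Require Import measurable_realfun ring lra.

Set Implicit Arguments.
Unset Strict Implicit.
Unset Printing Implicit Defensive.

Import Order.TTheory GRing.Theory Num.Theory.
Import numFieldNormedType.Exports.

Local Open Scope classical_set_scope.
Local Open Scope ring_scope.

(* Identification rests on Manski's sign argument.  Given (alpha, X), the two
   errors share a strictly increasing distribution function, so the sign of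
   P(Y_2 >= y_2 | X) - P(Y_1 >= y_1 | X) is that of
   (X_2 - X_1) beta - (h_2^-1(y_2) - h_1^-1(y_1)).  Two observationally
   equivalent structures therefore have almost surely equal half-spaces in
   X_2 - X_1.  Along the regressor with a positive conditional density the
   boundaries must coincide, so the two vectors (beta, threshold) are
   proportional on the support of W, hence everywhere by non-collinearity, and
   equal by the normalization of beta.  The residual g_t(Y_t) - X_t beta is then
   the same function of the observables in both structures and equals
   alpha - U_t - c_1; its conditional covariance across periods is
   Var(alpha | X) since the remaining covariances vanish. *)

(** * Conditional laws *)

Section cond_law.
Context {R : realType} {d d1 d2 : measure_display} {T : measurableType d}
  {T1 : measurableType d1} {T2 : measurableType d2}.
Implicit Types (P : probability T R) (V : {mfun T >-> T1}) (Z : T -> T2).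
Implicit Types kappa : {mfun T1 >-> pprobability T2 R}.

Lemma measurable_cond_law_xsection kappa (E : set (T1 * T2)) :
  measurable E ->
  measurable_fun setT
    (fun v => (kappa v : probability T2 R) (xsection E v)).
Proof.
move=> mE.
have mk : measurable_fun setT (kappa : T1 -> pprobability T2 R) by [].
apply: (measurable_fun_xsection_finite_kernel (kprobability mk)).
by rewrite inE.
Qed.

Lemma measurable_cond_law kappa (B : set T2) : measurable B ->
  measurable_fun setT (fun v => (kappa v : probability T2 R) B).
Proof.
move=> mB.
have mk : measurable_fun setT (kappa : T1 -> pprobability T2 R) by [].
exact: (@measurable_kernel _ _ _ _ _ (kprobability mk)).
Qed.

(** The definition covers rectangles only. These form a generating pi-system, and the sets
    satisfying the formula form a Dynkin system. *)
Lemma cond_law_joint P V Z kappa (E : set (T1 * T2)) :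
  is_cond_law P V Z kappa -> measurable_fun setT Z -> measurable E ->
  (P [set w | E (V w, Z w)] =
   \int[distribution P V]_v (kappa v : probability T2 R) (xsection E v))%E.
Proof.
move=> PVZ mZ mE.
have mVZ : measurable_fun setT (fun w => (V w, Z w)).
  by apply/measurable_fun_pairP; split => /=; [exact: measurable_funPT|].
have mpre (S : set (T1 * T2)) : measurable S ->
    measurable [set w | S (V w, Z w)].
  by move=> mS; rewrite -[X in measurable X]setTI; exact: mVZ.
have mxs := @measurable_cond_law_xsection kappa.
pose G := [set A `*` B | A in @measurable _ T1 & B in @measurable _ T2].
have mG : @measurable _ (T1 * T2)%type = <<s G >>.
  exact: measurable_prod_measurableType.
have hG S : G S -> (P [set w | S (V w, Z w)] =
    \int[distribution P V]_v (kappa v : probability T2 R) (xsection S v))%E.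
  move=> [A mA [B mB <-]].
  transitivity (P (V @^-1` A `&` Z @^-1` B)) => //.
  rewrite PVZ// integral_mkcond; apply: eq_integral => v _.
  rewrite patchE; case: ifPn => vA; first by rewrite in_xsectionX.
  by rewrite notin_xsectionX// measure0.
have hT : (P [set w | [set: T1 * T2] (V w, Z w)] =
    \int[distribution P V]_v (kappa v : probability T2 R) (xsection setT v))%E.
  by apply: hG; exists setT => //; exists setT => //; rewrite setXTT.
suff : forall S, <<s G >> S -> (P [set w | S (V w, Z w)] =
    \int[distribution P V]_v (kappa v : probability T2 R) (xsection S v))%E.
  by apply; rewrite -mG.
apply: (dynkin_induction mG) => //.
- move=> _ _ [A1 mA1 [B1 mB1 <-]] [A2 mA2 [B2 mB2 <-]].
  exists (A1 `&` A2); first exact: measurableI.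
  by exists (B1 `&` B2); [exact: measurableI|rewrite setXI].
- move=> S mS IH.
  rewrite (_ : [set w | (~` S) (V w, Z w)] = ~` [set w | S (V w, Z w)])//.
  rewrite probability_setC; last exact: mpre.
  rewrite [X in (1 - X)%E]IH.
  have Itot : (\int[distribution P V]_v (kappa v : probability T2 R) (xsection S v)
     + \int[distribution P V]_v (kappa v : probability T2 R) (xsection (~` S) v)
     = 1)%E.
    rewrite -ge0_integralD//; [|exact: mxs|by apply: mxs; exact: measurableC].
    rewrite (eq_integral (cst 1%E)).
      by rewrite integral_cst// mul1e [LHS]probability_setT.
    move=> v _ /=.
    have mSv := measurable_xsection v mS.
    have -> : xsection (~` S) v = ~` xsection S v.
      by apply/seteqP; split => z /=; rewrite !xsectionE.
    by rewrite probability_setC// addeC subeK// fin_num_measure.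
  rewrite -Itot addeAC subee ?add0e//.
  by rewrite -IH fin_num_measure//; exact: mpre.
- move=> F mF tF IH.
  have eseriesT (f : nat -> \bar R) :
      (\sum_(0 <= i <oo | i \in [set: nat]) f i = \sum_(0 <= i <oo) f i)%E.
    by apply: eq_eseriesl => i; rewrite in_setT.
  have -> : [set w | (\bigcup_k F k) (V w, Z w)] =
      \bigcup_k [set w | F k (V w, Z w)].
    by [].
  rewrite measure_bigcup//=; last 2 first.
  + by move=> n _; exact: mpre.
  + by move=> i j _ _ [w [Fi Fj]]; apply: tF => //; exists (V w, Z w).
  under eq_integral => v _.
    rewrite xsection_bigcup measure_bigcup//=; last 2 first.
    + by move=> n _; exact: measurable_xsection.
    + by move=> i j _ _ [z [/xsectionP Fi /xsectionP Fj]]; apply: tF => //; exists (v, z).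
    over.
  under eq_integral do rewrite eseriesT.
  rewrite eseriesT.
  rewrite integral_nneseries//; last by move=> n; exact: mxs.
  by apply: eq_eseriesr => n _; exact: IH.
Qed.

End cond_law.

(** * Stationarity and exceedance probabilities *)

(** The positive part [h] of [g - f] has zero integral only if it vanishes almost everywhere, which
    strictness on the non-null [N] forbids. As the integral of [f] is finite, adding a positive
    amount increases it strictly. *)
Lemma lt_integral_ae {d} {T : measurableType d} {R : realType}
    (mu : {measure set T -> \bar R}) (f g : T -> \bar R) (N : set T) :
  measurable_fun setT f -> measurable_fun setT g ->
  (forall x, (0 <= f x)%E) -> (forall x, (0 <= g x)%E) ->
  (forall x, f x \is a fin_num) ->
  (\int[mu]_x f x < +oo)%E -> measurable N -> mu N <> 0%E ->
  {ae mu, forall x, (f x <= g x)%E} ->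
  {ae mu, forall x, N x -> (f x < g x)%E} ->
  (\int[mu]_x f x < \int[mu]_x g x)%E.
Proof.
move=> mf mg f0 g0 ffin intf mN N0 fleg fltg.
pose h x := maxe (g x - f x)%E 0%E.
have mh : measurable_fun setT h.
  by apply: measurable_maxe => //; exact: emeasurable_funB.
have h0 x : (0 <= h x)%E by rewrite le_max lexx orbT.
have gE : (\int[mu]_x g x = \int[mu]_x f x + \int[mu]_x h x)%E.
  rewrite -ge0_integralD//; apply: ge0_ae_eq_integral => //.
  - exact: emeasurable_funD.
  - by move=> x _; exact: adde_ge0.
  - move: fleg; apply: filterS => x fg _.
    by rewrite /h max_l ?sube_ge0 ?ffin// addeC subeK.
rewrite gE lteDl ?ge0_fin_numE ?integral_ge0//.
rewrite lt_neqAle integral_ge0// andbT; apply/eqP => /esym inth.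
have hae : ae_eq mu setT h (cst 0%E).
  apply/ae_eq_integral_abs => //.
  by under eq_integral do rewrite gee0_abs//.
have : {ae mu, forall x, ~ N x}.
  move: hae fltg; apply: filterS2 => x /(_ I) /= hx0 /[apply].
  by rewrite -sube_gt0 ltNge -[X in (_ <= X)%E]hx0 /h le_max lexx.
move=> [M [mM M0 NM]]; apply: N0; apply: subset_measure0 M0 => //.
by move=> x Nx; apply: NM => /=; exact.
Qed.

Section stationarity.
Context {R : realType} {K : nat}.
Implicit Types (S : structure R K) (t : period) (A : set (covT R K)).

Definition covariates t (x : covT R K) : K.-tuple R :=
  match t with period1 => x.1 | period2 => x.2 end.

Definition lin_index (b : 'cV[R]_K) t (x : covT R K) : R :=
  \sum_(k < K) tnth (covariates t x) k * b k 0.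

Lemma XbetaE b t (w : latT R K) : Xbeta b t w = lin_index b t (Xs w).
Proof. by case: t. Qed.

Lemma measurable_index b t : measurable_fun setT (lin_index b t).
Proof.
apply: measurable_sum => k; apply: measurable_funM => //.
apply: (measurableT_comp (measurable_tnth _)).
by case: t; [exact: measurable_fst|exact: measurable_snd].
Qed.

Lemma measurable_U t : measurable_fun setT (@U R K t).
Proof.
case: t.
  exact: (measurableT_comp (@measurable_fst _ _ _ _) (@measurable_snd _ _ _ _)).
exact: (measurableT_comp (@measurable_snd _ _ _ _) (@measurable_snd _ _ _ _)).
Qed.

Lemma measurable_alpha : measurable_fun setT (@alpha R K).
Proof.
exact: (measurableT_comp (@measurable_fst _ _ _ _) (@measurable_fst _ _ _ _)).
Qed.

Definition latent S t (w : latT R K) : R :=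
  alpha w + Xbeta (beta S) t w - U t w.

Lemma measurable_latent S t : measurable_fun setT (latent S t).
Proof.
apply: measurable_funB; last exact: measurable_U.
apply: measurable_funD; first exact: measurable_alpha.
rewrite (_ : Xbeta _ _ = lin_index (beta S) t \o @Xs R K); last first.
  by apply/funext => w; rewrite XbetaE.
exact: (measurableT_comp (measurable_index _ _) (@measurable_Xs _ _)).
Qed.

(** For a strictly increasing link, [s <= latent S t w] says that the outcome is at least [h S t s],
    so the observed law determines the probability of this event. *)
Definition exceeds S t (s : R) A : set (latT R K) :=
  [set w | s <= latent S t w /\ A (Xs w)].

Lemma measurable_exceeds S t s A : measurable A -> measurable (exceeds S t s A).
Proof.
move=> mA; rewrite (_ : exceeds S t s A =
    [set w | s <= latent S t w] `&` Xs @^-1` A)//.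
apply: measurableI; last first.
  by rewrite -[X in measurable X]setTI; exact: measurable_Xs.
rewrite -[X in measurable X]setTI; apply: measurable_fun_le => //.
exact: measurable_latent.
Qed.

(** Conditional probability of [exceeds] given (alpha, X), the event being
    [U_t <= alpha + X_t beta - s]. The law [F] is kept apart from the period so that both periods
    can be evaluated under one law. *)
Definition cdf_section S t s A (F : pprobability R R)
    (ax : R * covT R K) : \bar R :=
  (F : probability R R)
    (if `[< A ax.2 >] then `]-oo, ax.1 + lin_index (beta S) t ax.2 - s]%classic
     else set0).

Lemma exceeds_integral S t s A (F : {mfun (R * covT R K)%type >->
    pprobability R R}) :
  measurable A -> is_cond_law (law S) alphaX (U t) F ->
  measurable_fun setT (fun ax => cdf_section S t s A (F ax) ax) /\
  (law S (exceeds S t s A) =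
   \int[distribution (law S) alphaX]_ax cdf_section S t s A (F ax) ax)%E.
Proof.
move=> mA HF.
pose E := [set z : (R * covT R K) * R |
  A z.1.2 /\ z.2 <= z.1.1 + lin_index (beta S) t z.1.2 - s].
have mE : measurable E.
  rewrite (_ : E = [set z | A z.1.2] `&`
      [set z | z.2 <= z.1.1 + lin_index (beta S) t z.1.2 - s])//.
  have mx : measurable_fun setT (fun z : (R * covT R K) * R => z.1.2).
    exact: (measurableT_comp (@measurable_snd _ _ _ _) (@measurable_fst _ _ _ _)).
  apply: measurableI; first by rewrite -[X in measurable X]setTI; exact: mx.
  rewrite -[X in measurable X]setTI.
  apply: measurable_fun_le => //.
  apply: measurable_funB => //; apply: measurable_funD.
    exact: (measurableT_comp (@measurable_fst _ _ _ _) (@measurable_fst _ _ _ _)).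
  exact: (measurableT_comp (measurable_index (beta S) t) mx).
have sec ax :
    (F ax : probability R R) (xsection E ax) = cdf_section S t s A (F ax) ax.
  rewrite /cdf_section xsectionE /E; congr (_ _).
  case: asboolP => Aax; apply/seteqP; split => u //=; rewrite ?in_itv//=.
  - by case.
  - by case.
split.
  by under eq_fun do rewrite -sec; exact: measurable_cond_law_xsection.
under eq_integral do rewrite -sec.
rewrite -(cond_law_joint HF (measurable_U t) mE).
congr (law S _); apply/seteqP; split => w;
  rewrite /exceeds /latent /E /= XbetaE => -[h1 h2]; split => //; move: h1 h2;
  rewrite /alpha /Xs; lra.
Qed.

Lemma cdf_section_ge0 S t s A (F : pprobability R R) ax :
  (0 <= cdf_section S t s A F ax)%E.
Proof. exact: measure_ge0. Qed.

Lemma cdf_section_fin_num S t s A (F : pprobability R R) ax :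
  cdf_section S t s A F ax \is a fin_num.
Proof. by apply: fin_num_measure; case: asboolP. Qed.

Lemma cdf_eq_cdf_section S t s A (F F' : pprobability R R) ax :
  (forall u, (F : probability R R) `]-oo, u]%classic =
     (F' : probability R R) `]-oo, u]%classic) ->
  cdf_section S t s A F ax = cdf_section S t s A F' ax.
Proof. by move=> FF'; rewrite /cdf_section; case: asboolP => // _; rewrite !measure0. Qed.

(** The open interval between [u] and [v] contains its midpoint, a support point, hence carries
    positive mass. *)
Lemma cdf_lt (mu : probability R R) (u v : R) :
  supp mu = setT -> u < v -> (mu `]-oo, u]%classic < mu `]-oo, v]%classic)%E.
Proof.
move=> smu uv.
have -> : `]-oo, v]%classic = `]-oo, u] `|` `]u, v] :> set R.
  by rewrite -(@itv_bndbnd_setU _ _ _ (BRight u)) // bnd_simp ltW.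
rewrite measureU//; last first.
  apply/seteqP; split => r //=; rewrite !in_itv/= => -[ru /andP[ur _]].
  by move: ur; rewrite ltNge ru.
rewrite lteDl ?fin_num_measure//.
have : supp mu ((u + v) / 2) by rewrite smu.
have uvm : `]u, v[%classic ((u + v) / 2) by rewrite /= in_itv/= !midf_lt.
move=> /(_ _ (itv_open _ _) uvm) /lt_le_trans; apply.
apply: le_measure; rewrite ?inE//.
by move=> r /=; rewrite !in_itv/= => /andP[-> /ltW].
Qed.

(* The sign of the index difference relative to the threshold difference is the
   sign of the difference of the exceedance probabilities, since both errors
   have the same, strictly increasing, conditional distribution function. *)
Section sign.
Variables (S : structure R K) (s1 s2 : R) (A : set (covT R K)).
Hypothesis Sstat : stationary_errors S.
Hypothesis mA : measurable A.

Let gap x := lin_index (beta S) period2 x - lin_index (beta S) period1 x.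

Lemma exceeds_le : A `<=` [set x | gap x <= s2 - s1] ->
  (law S (exceeds S period2 s2 A) <= law S (exceeds S period1 s1 A))%E.
Proof.
move=> Agap; have [F [HF FF _]] := Sstat.
have [m1 ->] := exceeds_integral s1 mA (HF period1).
have [m2 ->] := exceeds_integral s2 mA (HF period2).
apply: ae_ge0_le_integral => //; try by move=> *; exact: cdf_section_ge0.
(* Stationarity puts the period 1 law in both sections, leaving two nested half-lines. *)
move: FF; apply: filterS => ax /cdf_eq_cdf_section <- _.
rewrite /cdf_section; case: asboolP => // /Agap; rewrite /gap /= => h.
apply: le_measure; rewrite ?inE//.
by move=> r /=; rewrite !in_itv/=; lra.
Qed.

Lemma exceeds_lt : A `<=` [set x | s2 - s1 < gap x] -> law S (Xs @^-1` A) <> 0%E ->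
  (law S (exceeds S period1 s1 A) < law S (exceeds S period2 s2 A))%E.
Proof.
move=> Agap A0; have [F [HF FF sF]] := Sstat.
have [m1 E1] := exceeds_integral s1 mA (HF period1).
have [m2 E2] := exceeds_integral s2 mA (HF period2).
have lt12 : {ae distribution (law S) alphaX, forall ax, A ax.2 ->
    (cdf_section S period1 s1 A (F period1 ax) ax <
     cdf_section S period2 s2 A (F period2 ax) ax)%E}.
  move: FF sF; apply: filterS2 => ax /cdf_eq_cdf_section <- sF Aax.
  rewrite /cdf_section; case: asboolP => // /Agap; rewrite /gap /= => h.
  by apply: cdf_lt => //; lra.
(* Strictness holds where the regressors lie in [A], a set of positive probability; off [A] both
   sections vanish. *)
rewrite E1 E2; apply: (@lt_integral_ae _ _ _ _ _ _ [set ax | A ax.2]) => //.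
- by move=> ax; exact: cdf_section_fin_num.
- rewrite -E1; apply: le_lt_trans (ltry 1).
  by apply: probability_le1; exact: measurable_exceeds.
- by have := @measurable_snd _ _ R (covT R K) measurableT _ mA; rewrite setTI.
- move: lt12; apply: filterS => ax lt12.
  have [/lt12/ltW//|nA] := asboolP (A ax.2).
  by rewrite /cdf_section; case: asboolP => // _; rewrite !measure0.
Qed.

End sign.

End stationarity.

(** * Agreement of half-spaces *)

(** A zero integral over [A] would make the positive function [f] vanish almost everywhere on
    [A]. *)
Lemma density_null {R : realType} (mu : {measure set R -> \bar R}) (f : R -> R)
    (A : set R) :
  measurable_fun setT f -> (forall r, 0 < f r) ->
  (forall B, measurable B ->
     (mu B = \int[lebesgue_measure]_(r in B) (f r)%:E)%E) ->
  measurable A -> mu A = 0%E -> lebesgue_measure A = 0%E.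
Proof.
move=> mf f0 muE mA; rewrite muE// => intf.
have : ae_eq lebesgue_measure A (EFin \o f) (cst 0%E).
  apply/ae_eq_integral_abs => //.
    by apply/measurable_EFinP; exact: measurable_funTS.
  by under eq_integral do rewrite /= ger0_norm ?ltW//.
move=> [N [mN N0 AN]]; apply: subset_measure0 N0 => // r Ar.
by apply: AN => /= /(_ Ar) [fr0]; have := f0 r; rewrite fr0 ltxx.
Qed.

(** Weaker than being Lebesgue null, but enough to compare half-lines, and elementary to transport
    along reflections. *)
Definition interval_free {R : realType} (A : set R) :=
  forall u v, u < v -> ~ (`]u, v[%classic `<=` A).

Lemma null_interval_free {R : realType} (A : set R) :
  measurable A -> lebesgue_measure A = 0%E -> interval_free A.
Proof.
move=> mA A0 u v uv uvA.
have : (lebesgue_measure (`]u, v[%classic : set R) <= lebesgue_measure A)%E.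
  by apply: le_measure; rewrite ?inE.
by rewrite A0 lebesgue_measure_itv/= lte_fin uv leNgt -EFinD lte_fin subr_gt0 uv.
Qed.

Lemma interval_freeN {R : realType} (A : set R) :
  interval_free A -> interval_free [set r | A (- r)].
Proof.
move=> Afree u v uv uvA; apply: (Afree (- v) (- u)); first by rewrite ltrN2.
move=> r; rewrite /= in_itv/= => /andP[vr ru].
by rewrite -(opprK r); apply: uvA; rewrite /= in_itv/=; apply/andP; split; lra.
Qed.

Lemma sub_interval_free {R : realType} (A B : set R) :
  B `<=` A -> interval_free A -> interval_free B.
Proof. by move=> BA Afree u v /Afree uvA /subset_trans/(_ BA)/uvA. Qed.

(** The two half-lines differ by sets without intervals, so they point the same way and share the
    endpoint [- m / b = - m' / b'], stated here without denominators. *)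
Lemma halflines_agree {R : realType} (b m b' m' : R) : b != 0 ->
  interval_free [set r | 0 < b * r + m /\ b' * r + m' <= 0] ->
  interval_free [set r | 0 < b' * r + m' /\ b * r + m <= 0] ->
  0 < b * b' /\ b' * m = b * m'.
Proof.
wlog bpos : b b' / 0 < b => [hwlog b0 free free'|_].
  have [bpos|bneg|/eqP] := ltgtP 0 b; [exact: hwlog| |by rewrite eq_sym (negbTE b0)].
  have Nb : 0 < - b by rewrite oppr_gt0.
  (* For [b < 0], reflecting [r] negates both slopes and keeps the intercepts. *)
  have [|||] := hwlog (- b) (- b') Nb.
  - by rewrite oppr_eq0.
  - apply: sub_interval_free (interval_freeN free) => r.
    by rewrite /= !mulrN !mulNr.
  - apply: sub_interval_free (interval_freeN free') => r.
    by rewrite /= !mulrN !mulNr.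
  by rewrite mulrNN => ->; rewrite !mulNr => /oppr_inj.
pose r0 := - m / b.
have r0E r : (0 < b * r + m) = (r0 < r).
  by rewrite /r0 ltr_pdivrMr//; apply/idP/idP => ?; lra.
move=> free free'.
have b'pos : 0 < b'.
  rewrite ltNge; apply/negP => b'le0.
  (* A zero slope makes the second half-line empty or everything; an interval on one side of [r0]
     then lies in a difference. *)
  have [b'0|b'neq0] := eqVneq b' 0.
    have [m'le0|m'gt0] := leP m' 0.
      apply: (free r0 (r0 + 1)); first by rewrite ltrDl.
      move=> r; rewrite /= in_itv/= r0E b'0 mul0r add0r => /andP[-> _].
      by [].
    apply: (free' (r0 - 1) r0); first by rewrite ltrBlDr ltrDl.
    move=> r; rewrite /= in_itv/= b'0 mul0r add0r => /andP[_ /ltW rr0].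
    by split => //; rewrite leNgt r0E -leNgt.
  have b'neg : b' < 0 by rewrite lt_neqAle b'neq0.
  pose q := - m' / b'.
  have qE r : q < r -> b' * r + m' < 0.
    by rewrite /q ltr_ndivrMr// mulrC => h; lra.
  (* Opposite directions: to the right of both endpoints only the first inequality holds. *)
  apply: (free (Num.max r0 q) (Num.max r0 q + 1)); first by rewrite ltrDl.
  move=> r; rewrite /= in_itv/= gt_max => /andP[/andP[r0r /qE/ltW qr] _].
  by rewrite r0E.
split; first exact: mulr_gt0.
pose q := - m' / b'.
have qE r : (0 < b' * r + m') = (q < r).
  by rewrite /q ltr_pdivrMr//; apply/idP/idP => ?; lra.
(* Distinct endpoints would enclose an interval on which exactly one inequality holds. *)
have : r0 = q.
  apply/eqP; rewrite eq_le; apply/andP; split; rewrite leNgt; apply/negP => lt.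
  - apply: (free' _ _ lt) => r; rewrite /= in_itv/= => /andP[qr rr0].
    by rewrite qE; split => //; rewrite leNgt r0E -leNgt ltW.
  - apply: (free _ _ lt) => r; rewrite /= in_itv/= => /andP[qr rr0].
    by rewrite r0E; split => //; rewrite leNgt qE -leNgt ltW.
rewrite /r0 /q => /eqP; rewrite eqr_div ?lt0r_neq0// => /eqP; lra.
Qed.

Lemma measurable_lt_set {d} {T : measurableType d} {R : realType} (f g : T -> R) :
  measurable_fun setT f -> measurable_fun setT g ->
  measurable [set x | f x < g x].
Proof.
move=> mf mg; rewrite (_ : [set x | f x < g x] = ~` [set x | g x <= f x]).
  apply: measurableC; rewrite -[X in measurable X]setTI.
  exact: measurable_fun_le.
by apply/seteqP; split => x /=; rewrite ltNge => /negP.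
Qed.

Section half_spaces.
Context {R : realType} {K : nat}.
Implicit Types (S : structure R K) (w : latT R K).

(** Thresholds giving the same outcome level cut out the same event in terms of the observables. *)
Lemma same_observed_exceeds S S' t s s' (A : set (covT R K)) :
  (forall t, {homo h S t : s s' / s < s'}) ->
  (forall t, {homo h S' t : s s' / s < s'}) ->
  same_observed_law S S' -> h S t s = h S' t s' -> measurable A ->
  law S (exceeds S t s A) = law S' (exceeds S' t s' A).
Proof.
move=> hS hS' SS' hs mA.
pose pr (z : (R * R) * covT R K) :=
  match t with period1 => z.1.1 | period2 => z.1.2 end.
have mpr : measurable_fun setT pr.
  rewrite /pr; case: t {hs pr}.
    exact: (measurableT_comp (@measurable_fst _ _ _ _) (@measurable_fst _ _ _ _)).
  exact: (measurableT_comp (@measurable_snd _ _ _ _) (@measurable_fst _ _ _ _)).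
pose B := [set z : (R * R) * covT R K | h S t s <= pr z] `&` [set z | A z.2].
have mB : measurable B.
  apply: measurableI.
    by rewrite -[X in measurable X]setTI; exact: measurable_fun_le.
  by have := @measurable_snd _ _ (R * R)%type (covT R K) measurableT _ mA; rewrite setTI.
have E (S0 : structure R K) r : (forall t, {homo h S0 t : s s' / s < s'}) ->
    h S0 t r = h S t s -> exceeds S0 t r A = observables S0 @^-1` B.
  move=> hS0 hr; apply/seteqP.
  have prE w : pr (observables S0 w) = h S0 t (latent S0 t w).
    by rewrite /pr; case: (t).
  by split => w; rewrite /exceeds /B /= prE -hr (le_mono (hS0 t)).
by rewrite (E S)// (E S')// SS'.
Qed.

Lemma same_observed_Xs S S' (A : set (covT R K)) :
  same_observed_law S S' -> measurable A ->
  law S (Xs @^-1` A) = law S' (Xs @^-1` A).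
Proof.
move=> SS' mA.
have mB : measurable [set z : (R * R) * covT R K | A z.2].
  by have := @measurable_snd _ _ (R * R)%type (covT R K) measurableT _ mA; rewrite setTI.
exact: SS' mB.
Qed.

Definition index_gap (b : 'cV[R]_K) (x : covT R K) :=
  lin_index b period2 x - lin_index b period1 x.

Lemma measurable_index_gap b : measurable_fun setT (index_gap b).
Proof. by apply: measurable_funB; exact: measurable_index. Qed.

(** If this event had positive probability, exceedance on it would be strictly likelier in period 2
    under [S] but not under [S'], although observational equivalence equates the exceedance
    probabilities. *)
Lemma half_spaces_agree S S' (s1 s2 s1' s2' : R) :
  (forall t, {homo h S t : s s' / s < s'}) ->
  (forall t, {homo h S' t : s s' / s < s'}) ->
  stationary_errors S -> stationary_errors S' ->
  same_observed_law S S' ->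
  h S period1 s1 = h S' period1 s1' -> h S period2 s2 = h S' period2 s2' ->
  law S (Xs @^-1` [set x | s2 - s1 < index_gap (beta S) x /\
                           index_gap (beta S') x <= s2' - s1']) = 0%E.
Proof.
move=> hS hS' St St' SS' h1 h2.
set A := [set x | _ /\ _].
have mA : measurable A.
  apply: measurableI.
    by apply: measurable_lt_set => //; exact: measurable_index_gap.
  rewrite -[X in measurable X]setTI; apply: measurable_fun_le => //.
  exact: measurable_index_gap.
apply/eqP/negPn/negP => /eqP A0.
have lt12 := exceeds_lt St mA (fun x Ax => Ax.1) A0.
have le21 := exceeds_le St' mA (fun x (Ax : A x) => Ax.2).
move: lt12; rewrite (same_observed_exceeds hS hS' SS' h1 mA).
rewrite (same_observed_exceeds hS hS' SS' h2 mA).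
by rewrite ltNge le21.
Qed.

End half_spaces.

(** * From agreeing half-spaces to proportional index gaps *)

Section direction.
Context {R : realType} {K : nat}.
Implicit Types (S : structure R K) (w : latT R K).

Lemma index_gapE (b : 'cV[R]_K) w :
  index_gap b (Xs w) = \sum_(k < K) tnth (DX w) k * b k 0.
Proof.
rewrite /index_gap /lin_index -sumrB; apply: eq_bigr => k _.
by rewrite tnth_mktuple mulrBl.
Qed.

Definition others_index (k : 'I_K) (b : 'cV[R]_K) (z : (K.-1).-tuple R) : R :=
  \sum_(j < K.-1) tnth z j * b (lift k j) 0.

Lemma index_gap_others k (b : 'cV[R]_K) w :
  index_gap b (Xs w) = b k 0 * DX_at k w + others_index k b (DX_others k w).
Proof.
rewrite index_gapE (bigD1_ord k)//= mulrC; congr (_ + _).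
by apply: eq_bigr => j _; rewrite [in RHS]tnth_mktuple.
Qed.

Lemma measurable_others_index k b : measurable_fun setT (others_index k b).
Proof.
apply: measurable_sum => j; apply: measurable_funM => //.
exact: measurable_tnth.
Qed.

Lemma measurable_DX_at k : measurable_fun setT (@DX_at R K k).
Proof.
rewrite (_ : DX_at k = fun w => tnth (X period2 w) k - tnth (X period1 w) k).
  by apply: measurable_funB;
    apply: (measurableT_comp (measurable_tnth _) (measurable_X _)).
by apply/funext => w; rewrite /DX_at tnth_mktuple.
Qed.

(* Conditionally on the other regressors the [k]-th one has a positive density,
   so half-lines that agree almost surely have the same endpoint. *)
Lemma index_gap_proportional S (b b' : 'cV[R]_K) (c c' : R) (k : 'I_K)
    (kappa : {mfun ((K.-1).-tuple R) >-> pprobability R R}) :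
  b k 0 != 0 ->
  is_cond_law (law S) (DX_others k) (DX_at k) kappa ->
  {ae distribution (law S) (DX_others k), forall z,
    exists f : R -> R, [/\ measurable_fun setT f, forall r, 0 < f r
      & forall A : set R, measurable A ->
        ((kappa z : probability _ _) A =
         \int[lebesgue_measure]_(r in A) (f r)%:E)%E]} ->
  law S (Xs @^-1` [set x | c < index_gap b x /\ index_gap b' x <= c']) = 0%E ->
  law S (Xs @^-1` [set x | c' < index_gap b' x /\ index_gap b x <= c]) = 0%E ->
  0 < b k 0 * b' k 0 /\
  {ae law S, forall w, b' k 0 * (index_gap b (Xs w) - c) =
                       b k 0 * (index_gap b' (Xs w) - c')}.
Proof.
move=> bk0 HK dens n1 n2.
pose m (a : 'cV[R]_K) e z := others_index k a z - e.
have mm a e : measurable_fun setT (m a e).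
  by apply: measurable_funB => //; exact: measurable_others_index.
(* Values of the other regressors and the k-th one that lie in the first half-space but not in the
   second. *)
pose E (a : 'cV[R]_K) e (a' : 'cV[R]_K) e' := [set q : (K.-1).-tuple R * R |
   0 < a k 0 * q.2 + m a e q.1 /\ a' k 0 * q.2 + m a' e' q.1 <= 0].
have mE a e a' e' : measurable (E a e a' e').
  have mq (x : 'cV[R]_K) y : measurable_fun setT
      (fun q : (K.-1).-tuple R * R => x k 0 * q.2 + m x y q.1).
    apply: measurable_funD; first by apply: measurable_funM.
    exact: (measurableT_comp (mm x y) (@measurable_fst _ _ _ _)).
  apply: measurableI; first exact: measurable_lt_set.
  by rewrite -[X in measurable X]setTI; exact: measurable_fun_le.
(* Disintegration makes almost every fibre of a null disagreement null under [kappa z], hence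
   Lebesgue null by the positive density. *)
have fiber a e a' e' :
    law S (Xs @^-1` [set x | e < index_gap a x /\ index_gap a' x <= e']) = 0%E ->
    {ae distribution (law S) (DX_others k), forall z,
      interval_free [set r | 0 < a k 0 * r + m a e z /\
                             a' k 0 * r + m a' e' z <= 0]}.
  move=> null.
  have := cond_law_joint HK (measurable_DX_at k) (mE a e a' e').
  rewrite (_ : [set w | _] = Xs @^-1` [set x | e < index_gap a x /\ index_gap a' x <= e']); last first.
    apply/seteqP; split => w; rewrite /E /= !(index_gap_others k) /m.
      by move=> [? ?]; split; lra.
    by move=> [? ?]; split; lra.
  rewrite null => /esym int0.
  have : ae_eq (distribution (law S) (DX_others k)) setT
      (fun z => (kappa z : probability R R) (xsection (E a e a' e') z)) (cst 0%E).
    apply/ae_eq_integral_abs => //; first exact: measurable_cond_law_xsection.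
    by under eq_integral do rewrite gee0_abs//.
  move: dens; apply: filterS2 => z [f [mf f0 fE]] /(_ I) kz.
  have secE : xsection (E a e a' e') z =
      [set r | 0 < a k 0 * r + m a e z /\ a' k 0 * r + m a' e' z <= 0].
    by rewrite xsectionE.
  have msec := measurable_xsection z (mE a e a' e').
  by rewrite -secE; exact: null_interval_free (density_null mf f0 fE msec kz).
have agree : {ae distribution (law S) (DX_others k), forall z,
    0 < b k 0 * b' k 0 /\ b' k 0 * m b c z = b k 0 * m b' c' z}.
  move: (fiber _ _ _ _ n1) (fiber _ _ _ _ n2); apply: filterS2 => z.
  exact: halflines_agree.
split.
  (* The sign condition is free of [z], so one good [z] suffices; one exists because the law has
     mass 1. *)
  have [z [//]] : exists z, 0 < b k 0 * b' k 0 /\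
      b' k 0 * m b c z = b k 0 * m b' c' z.
    apply: contrapT => nz; move: agree => [N [mN N0 sub]].
    have : (distribution (law S) (DX_others k) setT <= 0)%E.
      rewrite -N0; apply: le_measure; rewrite ?inE//.
      by move=> z _; apply: sub => /= zP; apply: nz; exists z.
    by rewrite [X in (X <= _)%E]probability_setT leNgt lte01.
move: agree => [N [mN N0 sub]]; exists (DX_others k @^-1` N); split => //.
  by rewrite -[X in measurable X]setTI; exact: measurable_funPT.
apply: subset_trans (preimage_subset sub) => w /= nw [_ eq]; apply: nw.
by rewrite !(index_gap_others k) /m in eq *; lra.
Qed.

End direction.

(** * Coefficients and threshold differences *)

Section parameters.
Context {R : realType} {K : nat}.
Implicit Types (S : structure R K) (w : latT R K).

(** With [theta] stacking [a] and [e], the hypothesis says that [W w *m theta] vanishes almost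
    surely, so the support of [W] lies in the kernel of [theta]. Non-collinearity makes this kernel
    the whole space. *)
Lemma index_gap_ae_cst S (a : 'cV[R]_K) (e : R) :
  no_collinearity S -> {ae law S, forall w, index_gap a (Xs w) = e} ->
  a = 0 /\ e = 0.
Proof.
move=> Scol ae.
pose theta : 'cV[R]_(K + 1) := col_mx a (const_mx e).
have WE w : (W w *m theta) 0 0 = index_gap a (Xs w) - e.
  rewrite /W /theta mul_row_col mxE !mxE index_gapE big_ord1 !mxE mulN1r.
  by congr (_ - _); apply: eq_bigr => k _; rewrite mxE.
pose V := lker (linfun (mulmxr theta : 'rV[R]_(K + 1) -> 'rV[R]_1)).
have memV v : (v \in V) = (v *m theta == 0) by rewrite memv_ker lfunE.
have [Vfull|Vproper] := EM (V = fullv).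
  have theta0 : theta = 0.
    apply/row_matrixP => i; rewrite row0 rowE; apply/eqP.
    by rewrite -memV Vfull memvf.
  split.
    by have /(congr1 usubmx) := theta0; rewrite col_mxKu linear0.
  have /(congr1 (fun A => dsubmx A 0 0)) := theta0.
  by rewrite col_mxKd !mxE.
exfalso; apply: (Scol V Vproper) => x xsupp /=; rewrite memV.
apply/negPn/negP => x0.
(* The complement of the kernel is open and has mass zero under the law of [W], so it contains no
   support point. *)
pose O := [set v : 'rV[R]_(K + 1) | (v *m theta) 0 0 != 0].
have oO : open O.
  have -> : O = (fun v : 'rV[R]_(K + 1) => \sum_j v 0 j * theta j 0) @^-1`
      [set r | r != 0].
    by apply/seteqP; split => v; rewrite /O /= mxE.
  apply: open_comp; last exact: open_neq.
  move=> v _; apply: (@continuous_big R _ +%R 0 xpredT _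
    'rV[R]_(K + 1) _ (fun j (v : 'rV[R]_(K + 1)) => v 0 j * theta j 0)).
    exact: add_continuous.
  move=> j _ u.
  exact: (cvgM (@coord_continuous R 1 (K + 1) 0 j u) (cvg_cst (theta j 0))).
have Ox : O x.
  rewrite /O /=; apply: contra x0 => /eqP x0; apply/eqP/matrixP => i j.
  by rewrite !ord1 x0 mxE.
have mWO : measurable (W @^-1` O : set (latT R K)).
  have -> : W @^-1` O = ~` ((index_gap a \o Xs) @^-1` [set e]).
    apply/seteqP; split => w; rewrite /O /= WE subr_eq0 => /eqP //.
  apply: measurableC; rewrite -[X in measurable X]setTI.
  exact: (measurableT_comp (measurable_index_gap a) (@measurable_Xs R K)).
have := xsupp O oO Ox; rewrite (_ : law S _ = 0%E) ?ltxx//.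
have [N [mN N0 sub]] := ae; apply: subset_measure0 N0 => //.
move=> w; rewrite /O /= WE => /negP we; apply: sub => /= wE; apply: we.
by rewrite wE subrr.
Qed.

Lemma index_gap_lin (u v : R) (b b' : 'cV[R]_K) x :
  index_gap (u *: b - v *: b') x = u * index_gap b x - v * index_gap b' x.
Proof.
have lin t : lin_index (u *: b - v *: b') t x =
    u * lin_index b t x - v * lin_index b' t x.
  rewrite /lin_index !mulr_sumr -sumrB; apply: eq_bigr => k _.
  by rewrite !mxE; ring.
by rewrite /index_gap !lin; ring.
Qed.

(** Comparing norms gives [u ^+ 2 = v ^+ 2]; the common sign excludes [u = - v]. *)
Lemma unit_sphere_proportional (b b' : 'cV[R]_K) (u v : R) :
  unit_sphere b -> unit_sphere b' -> 0 < u * v -> u *: b = v *: b' -> u = v.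
Proof.
have sum1 (a : 'cV[R]_K) : unit_sphere a -> \sum_(k < K) a k 0 ^+ 2 = 1.
  move=> a1; have := sqr_sqrtr (sumr_ge0 (index_enum 'I_K) (P := xpredT)
    (fun k _ => sqr_ge0 (a k 0))).
  by rewrite a1 expr1n.
move=> /sum1 b1 /sum1 b'1 uv eq.
have : u ^+ 2 = v ^+ 2.
  rewrite -[LHS]mulr1 -[RHS]mulr1 -{1}b1 -{1}b'1 !mulr_sumr.
  apply: eq_bigr => k _; rewrite -!exprMn; congr (_ ^+ 2).
  by have /matrixP/(_ k 0) := eq; rewrite !mxE.
move=> /eqP; rewrite eqf_sqr => /orP[/eqP //|/eqP uNv].
by move: uv; rewrite uNv mulNr oppr_gt0 ltNge -expr2 sqr_ge0.
Qed.

Lemma parameters_identified S S' (s1 s2 s1' s2' : R) :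
  (forall t, {homo h S t : s s' / s < s'}) ->
  (forall t, {homo h S' t : s s' / s < s'}) ->
  stationary_errors S -> stationary_errors S' ->
  continuous_regressor S -> no_collinearity S ->
  unit_sphere (beta S) -> unit_sphere (beta S') ->
  same_observed_law S S' ->
  h S period1 s1 = h S' period1 s1' -> h S period2 s2 = h S' period2 s2' ->
  beta S = beta S' /\ s2 - s1 = s2' - s1'.
Proof.
move=> hS hS' St St' [k [bk0 [kappa [HK dens]]]] Scol b1 b'1 SS' h1 h2.
have S'S : same_observed_law S' S by move=> A mA; rewrite SS'.
have n1 := half_spaces_agree hS hS' St St' SS' h1 h2.
have n2 := half_spaces_agree hS' hS St' St S'S (esym h1) (esym h2).
(* An event in the regressors alone, null under [S'], is null under [S] as well. *)
rewrite -(same_observed_Xs SS') in n2; last first.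
  apply: measurableI.
    by apply: measurable_lt_set => //; exact: measurable_index_gap.
  rewrite -[X in measurable X]setTI; apply: measurable_fun_le => //.
  exact: measurable_index_gap.
have [bb' prop] := index_gap_proportional bk0 HK dens n1 n2.
(* Proportionality says that this combination has an almost surely constant index gap, so the
   combination and the constant are both zero. *)
have [|b0 c0] := @index_gap_ae_cst S
    (beta S' k 0 *: beta S - beta S k 0 *: beta S')
    (beta S' k 0 * (s2 - s1) - beta S k 0 * (s2' - s1')) Scol.
  by move: prop; apply: filterS => w; rewrite index_gap_lin; lra.
(* The normalization equates the k-th coefficients, which can then be cancelled. *)
have kk : beta S' k 0 = beta S k 0.
  apply: (unit_sphere_proportional b1 b'1); first by rewrite mulrC.
  by apply/eqP; rewrite -subr_eq0 b0.
rewrite kk in b0 c0; split.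
  apply: (scalerI bk0); apply/eqP; rewrite -subr_eq0; exact/eqP.
apply: (mulfI bk0); apply/eqP; rewrite -subr_eq0; exact/eqP.
Qed.

End parameters.

(** * Equality of conditional laws on the plane *)

Section law_of_pairs.
Context {R : realType}.

(** A countable pi-system generating the Borel sets of the plane, so that the exceptional null sets
    can be merged. *)
Definition rat_quadrant (q : rat * rat) : set (R * R) :=
  [set z | z.1 <= ratr q.1 /\ z.2 <= ratr q.2].

Lemma measurable_rat_quadrant q : measurable (rat_quadrant q).
Proof.
rewrite (_ : rat_quadrant q =
    `]-oo, ratr q.1]%classic `*` `]-oo, ratr q.2]%classic).
  exact: measurableX.
by apply/seteqP; split => z; rewrite /rat_quadrant /= !in_itv.
Qed.

Lemma rat_quadrant_setI : setI_closed (range rat_quadrant).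
Proof.
move=> _ _ [p _ <-] [q _ <-]; exists (Num.min p.1 q.1, Num.min p.2 q.2) => //.
have ratr_min (a b : rat) (x : R) :
    (x <= ratr (Num.min a b)) = (x <= ratr a) && (x <= ratr b).
  have [ab|/ltW ba] := leP a b; apply/idP/andP => [xr|[xa xb]] //; split => //.
    by apply: le_trans xr _; rewrite ler_rat.
  by apply: le_trans xr _; rewrite ler_rat.
apply/seteqP; split => z; rewrite /rat_quadrant /= !ratr_min.
  by move=> [/andP[-> ->] /andP[-> ->]].
by move=> [[-> ->] [-> ->]].
Qed.

Lemma measurable_rat_quadrantE :
  @measurable _ (R * R)%type = <<s range rat_quadrant >>.
Proof.
apply/seteqP; split; last first.
  apply: smallest_sub; first exact: sigma_algebra_measurable.
  by move=> _ [q _ <-]; exact: measurable_rat_quadrant.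
pose G := g_sigma_algebraType (range rat_quadrant).
have mG q : @measurable _ G (rat_quadrant q).
  by apply: sub_sigma_algebra; exists q.
have lt_rat (x y : R) : x < y -> exists2 q : rat, x <= ratr q & ratr q < y.
  by move=> /rat_in_itvoo[q]; rewrite in_itv/= => /andP[/ltW xq qy]; exists q.
have ge_rat (x : R) : exists q : rat, x <= ratr q.
  by have [|q xq _] := lt_rat x (x + 1); [rewrite ltrDl|exists q].
have mfst : measurable_fun setT (fst : G -> R).
  apply: (measurability _ (RGenInftyO.measurableE R)) => _ [_ [x ->] <-].
  (* Here [p] is squeezed between [z.1] and [x], while [q] only has to bound [z.2]. *)
  rewrite setTI (_ : _ @^-1` _ = \bigcup_(p : rat) \bigcup_(q : rat)
      (if ratr p < x then rat_quadrant (p, q) else set0)).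
    apply: bigcupT_measurable_rat => p; apply: bigcupT_measurable_rat => q.
    by case: ifP => _; [exact: mG|exact: measurable0].
  apply/seteqP; split => z; rewrite /= in_itv/=.
    move=> /lt_rat[p zp px]; have [q zq] := ge_rat z.2.
    by exists p => //; exists q => //; rewrite px.
  by move=> [p _ [q _]]; case: ifP => // px [/= zp _]; exact: le_lt_trans px.
have msnd : measurable_fun setT (snd : G -> R).
  apply: (measurability _ (RGenInftyO.measurableE R)) => _ [_ [x ->] <-].
  rewrite setTI (_ : _ @^-1` _ = \bigcup_(p : rat) \bigcup_(q : rat)
      (if ratr q < x then rat_quadrant (p, q) else set0)).
    apply: bigcupT_measurable_rat => p; apply: bigcupT_measurable_rat => q.
    by case: ifP => _; [exact: mG|exact: measurable0].
  apply/seteqP; split => z; rewrite /= in_itv/=.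
    move=> /lt_rat[q zq qx]; have [p zp] := ge_rat z.1.
    by exists p => //; exists q => //; rewrite qx.
  by move=> [p _ [q _]]; case: ifP => // qx [/= _ zq]; exact: le_lt_trans qx.
apply: smallest_sub; first exact: smallest_sigma_algebra.
rewrite subUset; split => _ [A mA <-].
  exact: mfst.
exact: msnd.
Qed.

(** For fixed [B], integrals over all [A] determine the conditional probability up to a null set.
    One null set serves all rational quadrants, and these determine a law on the plane. *)
Lemma cond_law_pair_unique {d d' d1 : measure_display}
    {T : measurableType d} {T' : measurableType d'} {T1 : measurableType d1}
    (P : probability T R) (P' : probability T' R)
    (V : {mfun T >-> T1}) (V' : {mfun T' >-> T1})
    (kappa : {mfun T1 >-> pprobability T R})
    (kappa' : {mfun T1 >-> pprobability T' R})
    (Z : {mfun T >-> (R * R)%type}) (Z' : {mfun T' >-> (R * R)%type}) :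
  is_cond_law P V id kappa -> is_cond_law P' V' id kappa' ->
  (forall A B, measurable A -> measurable B ->
    P (V @^-1` A `&` Z @^-1` B) = P' (V' @^-1` A `&` Z' @^-1` B)) ->
  {ae distribution P V, forall v, forall B, measurable B ->
    (kappa v : probability T R) (Z @^-1` B) =
    (kappa' v : probability T' R) (Z' @^-1` B)}.
Proof.
move=> HP HP' PP'.
have mpre B : measurable B -> measurable (Z @^-1` B).
  by move=> mB; rewrite -[X in measurable X]setTI; exact: measurable_funPT.
have mpre' B : measurable B -> measurable (Z' @^-1` B).
  by move=> mB; rewrite -[X in measurable X]setTI; exact: measurable_funPT.
have PVP'V' A : measurable A -> distribution P V A = distribution P' V' A.
  by move=> mA; have := PP' A setT mA measurableT; rewrite !preimage_setT !setIT.
have one B : measurable B -> {ae distribution P V, forall v,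
    (kappa v : probability T R) (Z @^-1` B) =
    (kappa' v : probability T' R) (Z' @^-1` B)}.
  move=> mB.
  have mk := measurable_cond_law kappa (mpre _ mB).
  have mk' := measurable_cond_law kappa' (mpre' _ mB).
  have : ae_eq (distribution P V) setT
      (fun v => (kappa v : probability T R) (Z @^-1` B))
      (fun v => (kappa' v : probability T' R) (Z' @^-1` B)).
    apply: integral_ae_eq => //.
      apply/integrableP; split => //; apply: (@le_lt_trans _ _ 1%E); last exact: ltry.
      rewrite -(@probability_setT _ _ _ (distribution P V)) -[leRHS]mul1e.
      rewrite -integral_cst//; apply: ge0_le_integral => //.
        by apply: measurableT_comp.
      move=> v _; rewrite gee0_abs//; apply: probability_le1; exact: mpre.
    move=> A _ mA; rewrite -HP//; last exact: mpre.
    rewrite preimage_id PP'// -[X in P' (_ `&` X)]preimage_id HP'//; last exact: mpre'.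
    apply: eq_measure_integral => C mC _; exact/esym/PVP'V'.
  by apply: filterS => v; apply.
(* An enumeration of the rational quadrants; a code of no pair defaults to (0, 0), which only
   repeats a quadrant. *)
pose quad n := rat_quadrant (odflt (0, 0) (unpickle n)).
have : {ae distribution P V, forall v, forall n,
    (kappa v : probability T R) (Z @^-1` quad n) =
    (kappa' v : probability T' R) (Z' @^-1` quad n)}.
  by apply/ae_foralln => n; apply: one; exact: measurable_rat_quadrant.
apply: filterS => v eqv B mB.
apply: (@measure_unique _ _ _ (range rat_quadrant)
  (fun n => rat_quadrant (n%:R, n%:R)) _ _ _ _
  (distribution (kappa v : probability T R) Z)
  (distribution (kappa' v : probability T' R) Z')) => //.
- exact: measurable_rat_quadrantE.
- exact: rat_quadrant_setI.
- apply/seteqP; split => // z _.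
  exists (maxn (Num.truncn `|z.1|).+1 (Num.truncn `|z.2|).+1) => //.
  by rewrite /rat_quadrant /= ratr_nat; split; apply: (le_trans (ler_norm _));
    apply: ltW; apply: (lt_le_trans (truncnS_gt _)); rewrite ler_nat leq_max leqnn ?orbT.
- move=> _ [q _ <-]; have := eqv (pickle q).
  by rewrite /quad pickleK.
- by move=> n; apply: le_lt_trans (ltry 1); apply: probability_le1;
    exact: measurable_rat_quadrant.
Qed.

(** Change of variables. Positive and negative parts are transported separately, so infinite
    expectations are covered too. *)
Lemma covariance_same_law {d d' : measure_display}
    {T : measurableType d} {T' : measurableType d'}
    (P : probability T R) (P' : probability T' R)
    (Z : {mfun T >-> (R * R)%type}) (Z' : {mfun T' >-> (R * R)%type}) :
  (forall B, measurable B -> P (Z @^-1` B) = P' (Z' @^-1` B)) ->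
  covariance P (fst \o Z) (snd \o Z) = covariance P' (fst \o Z') (snd \o Z').
Proof.
move=> PP'.
have E (f : R * R -> R) : measurable_fun setT f ->
    ('E_P[f \o Z] = 'E_P'[f \o Z'])%E.
  move=> mf; have mEf : measurable_fun setT (EFin \o f).
    exact: measurableT_comp.
  have pull (g : R * R -> \bar R) : measurable_fun setT g ->
      (forall z, (0 <= g z)%E) ->
      (\int[P]_w (g \o Z) w = \int[P']_w (g \o Z') w)%E.
    move=> mg g0; rewrite -!ge0_integral_distribution//.
    by apply: eq_measure_integral => B mB _; exact: PP'.
  rewrite unlock; pose F := EFin \o f.
  change (\int[P]_w (F \o Z) w = \int[P']_w (F \o Z') w)%E.
  rewrite [LHS]integralE [RHS]integralE.
  have mFp : measurable_fun setT F^\+%E by exact: measurable_funepos.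
  have mFn : measurable_fun setT F^\-%E by exact: measurable_funeneg.
  have -> : ((F \o Z)^\+ = F^\+ \o Z)%E by exact: funepos_comp.
  have -> : ((F \o Z')^\+ = F^\+ \o Z')%E by exact: funepos_comp.
  have -> : ((F \o Z)^\- = F^\- \o Z)%E by exact: funeneg_comp.
  have -> : ((F \o Z')^\- = F^\- \o Z')%E by exact: funeneg_comp.
  by rewrite (pull _ mFp (funepos_ge0 F)) (pull _ mFn (funeneg_ge0 F)).
rewrite !covariance.unlock (E fst)// (E snd)//.
(* The means now coincide, so both sides are expectations of one function of the pair. *)
set a := fine _; set b := fine _.
apply: (E (fun z => (z.1 - a) * (z.2 - b))).
by apply: measurable_funM; apply: measurable_funB.
Qed.

End law_of_pairs.

(** * Covariance of the residuals *)

Section covariance_residuals.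
Local Open Scope ereal_scope.
Context {d} {T : measurableType d} {R : realType} (P : probability T R).

Lemma mul_funB (A B C : T -> R) : ((A \- B) * C = A * C \- B * C)%R.
Proof. by apply/funext => w; exact: mulrBl. Qed.

Lemma Lfun1_cstM (c : R) (A : T -> R) :
  A \in Lfun P 1 -> (cst c * A)%R \in Lfun P 1.
Proof.
move=> A1; rewrite (_ : (cst c * A)%R = (c \o* A)%R); first exact: Lfun_scale.
by apply/funext => w; exact: mulrC.
Qed.

(* [covarianceBl] of the library asks for square integrability, which the
   errors need not satisfy. *)
Lemma covarianceBl_Lfun1 (A B C : T -> R) :
  A \in Lfun P 1 -> B \in Lfun P 1 -> C \in Lfun P 1 ->
  (A * C)%R \in Lfun P 1 -> (B * C)%R \in Lfun P 1 ->
  covariance P (A \- B)%R C = covariance P A C - covariance P B C.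
Proof.
move=> A1 B1 C1 AC1 BC1.
have AB1 : (A \- B)%R \in Lfun P 1 by rewrite rpredB.
rewrite !covarianceE//; last by rewrite mul_funB rpredB.
rewrite mul_funB !expectationB//.
have /fineK <- := expectation_fin_num A1.
have /fineK <- := expectation_fin_num B1.
have /fineK <- := expectation_fin_num C1.
have /fineK <- := expectation_fin_num AC1.
have /fineK <- := expectation_fin_num BC1.
by rewrite -!EFinM -!EFinB -?EFinM -?EFinB; congr EFin; ring.
Qed.

Lemma covariance_subr_cst (A B : T -> R) (c : R) :
  A \in Lfun P 1 -> B \in Lfun P 1 -> (A * B)%R \in Lfun P 1 ->
  covariance P (fun w => A w - c)%R B = covariance P A B.
Proof.
move=> A1 B1 AB1.
have c1 : cst c \in Lfun P 1 by rewrite Lfun_cst.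
rewrite -/(A \- cst c)%R covarianceBl_Lfun1// ?covariance_cst_l ?sube0//.
exact: Lfun1_cstM.
Qed.

(** By bilinearity [c] drops out, leaving the covariance of [a] with itself and three cross terms,
    each zero by hypothesis. *)
Lemma covariance_residuals (a u1 u2 : T -> R) (c : R) :
  finite_covariance P a a -> finite_covariance P a u1 ->
  finite_covariance P a u2 -> finite_covariance P u1 u2 ->
  covariance P a u1 = 0 -> covariance P a u2 = 0 -> covariance P u1 u2 = 0 ->
  covariance P (fun w => a w - u2 w - c)%R (fun w => a w - u1 w - c)%R =
  'V_P[a].
Proof.
move=> [a1 _ aa] [_ u11 au1] [_ u21 au2] [_ _ u12] c1 c2 c12.
have {}a1 : a \in Lfun P 1 by apply/Lfun1_integrable.
have {}u11 : u1 \in Lfun P 1 by apply/Lfun1_integrable.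
have {}u21 : u2 \in Lfun P 1 by apply/Lfun1_integrable.
have {}aa : (a * a)%R \in Lfun P 1 by apply/Lfun1_integrable.
have {}au1 : (a * u1)%R \in Lfun P 1 by apply/Lfun1_integrable.
have {}au2 : (a * u2)%R \in Lfun P 1 by apply/Lfun1_integrable.
have {}u12 : (u1 * u2)%R \in Lfun P 1 by apply/Lfun1_integrable.
have r11 : (a \- u1)%R \in Lfun P 1 by rewrite rpredB.
have r21 : (a \- u2)%R \in Lfun P 1 by rewrite rpredB.
have ar1 : ((a \- u1) * a)%R \in Lfun P 1.
  by rewrite mul_funB [(u1 * a)%R]mulrC rpredB.
have ur1 : ((a \- u1) * u2)%R \in Lfun P 1 by rewrite mul_funB rpredB.
have rr : ((a \- u2) * (a \- u1))%R \in Lfun P 1.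
  by rewrite mul_funB ![(_ * (a \- u1))%R]mulrC rpredB.
have cst1 : cst c \in Lfun P 1 by rewrite Lfun_cst.
rewrite (covariance_subr_cst c r21)//; last 2 first.
- by rewrite -/((a \- u1) \- cst c)%R rpredB.
- rewrite -/((a \- u1) \- cst c)%R mulrC mul_funB rpredB ?Lfun1_cstM//.
  by rewrite mulrC.
rewrite covarianceC (covariance_subr_cst c r11)//; last by rewrite mulrC.
rewrite covarianceC covarianceBl_Lfun1//; last 2 first.
- by rewrite mulrC.
- by rewrite mulrC.
rewrite [X in X - _]covarianceC [X in _ - X]covarianceC.
rewrite !covarianceBl_Lfun1//; last by rewrite mulrC.
by rewrite c12 c2 (covarianceC _ u1) c1 !sube0.
Qed.

End covariance_residuals.

(** * Links and joint law of the net effects *)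

Section identification.
Context {R : realType} {K : nat}.
Implicit Types (S : structure R K) (w : latT R K).

Lemma hinvK S t : {homo h S t : s s' / s < s'} -> cancel (h S t) (hinv S t).
Proof.
move=> hS s; apply: pinvKV; last by rewrite inE.
by move=> x y _ _; exact: (inc_inj (le_mono hS)).
Qed.

(** For strictly increasing links and [c = hinv S period1 y0] these are the residuals of periods 2
    and 1, in the order of the covariance formula. Written without the links, they are plainly
    measurable. *)
Definition net_effects (c : R) w : R * R :=
  (alpha w - U period2 w - c, alpha w - U period1 w - c).

Lemma measurable_net_effects c : measurable_fun setT (net_effects c).
Proof.
by apply/measurable_fun_pairP; split => /=; apply: measurable_funB => //;
  apply: measurable_funB; (exact: measurable_alpha || exact: measurable_U).
Qed.
HB.instance Definition _ c := isMeasurableFun.Build _ _ _ _ (net_effects c)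
  (measurable_net_effects c).

Lemma residualE S y0 t : {homo h S t : s s' / s < s'} ->
  residual S y0 t =
    (fun w => alpha w - U t w - hinv S period1 y0).
Proof.
move=> hS; apply/funext => w; rewrite /residual /g /outcome hinvK//; ring.
Qed.

(* The inverse of [f] extends to the line as the monotone, hence measurable,
   \bar R-valued map y |-> sup {s | f s <= y}; [fine] then makes it real. *)
Lemma measurable_left_inverse (f : R -> R) : {homo f : s s' / s < s'} ->
  exists2 k : R -> R, measurable_fun setT k & cancel f k.
Proof.
move=> fmono.
pose k (y : R) : \bar R := ereal_sup (EFin @` [set s | f s <= y]).
have knd x y : x <= y -> (k x <= k y)%E.
  move=> xy; apply: le_ereal_sup => _ [s sx <-]; exists s => //=.
  exact: le_trans xy.
exists (fine \o k).
  apply: (measurableT_comp (@fine_measurable R setT measurableT)).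
  apply: (measurability _ (ErealGenInftyO.measurableE R)) => _ [_ [x ->] <-].
  rewrite setTI; apply: is_interval_measurable => u v /=.
  rewrite !in_itv/= => ux vx r /andP[_ rv].
  exact: le_lt_trans (knd _ _ rv) vx.
move=> s /=; rewrite /k (_ : ereal_sup _ = s%:E)//.
apply/eqP; rewrite eq_le; apply/andP; split.
  by apply: ub_ereal_sup => _ [r /= + <-]; rewrite (le_mono fmono).
by apply: ereal_sup_ubound; exists s => /=.
Qed.

(* Only the differences of thresholds are identified, hence the common shift
   of the arguments of the two links. *)
Lemma links_identified (Y : set R) (y0 : R) S S' P P' :
  lower_trim Y y0 -> admissible Y S P -> admissible Y S' P' ->
  same_observed_law S S' ->
  beta S = beta S' /\
  forall t s, h S t (s + hinv S period1 y0) = h S' t (s + hinv S' period1 y0).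
Proof.
move=> hy0 aS aS' SS'.
have [b1 _] := adm_parameter aS hy0 hy0.
have [b'1 _] := adm_parameter aS' hy0 hy0.
have mS := adm_strict aS; have mS' := adm_strict aS'.
have id s1 s2 s1' s2' := @parameters_identified R K S S' s1 s2 s1' s2' mS mS'
  (adm_errors aS) (adm_errors aS') (adm_continuous aS) (adm_support aS)
  b1 b'1 SS'.
have rS t : range (h S t) = Y by case: (adm_link aS t).
have rS' t : range (h S' t) = Y by case: (adm_link aS' t).
(* All links have the common range [Y], so each outcome level is attained in both structures. *)
have matching t s : exists s', h S t s = h S' t s'.
  have : range (h S' t) (h S t s) by rewrite rS' -(rS t); exists s.
  by move=> [s' _ <-]; exists s'.
have [c _ cy0] : range (h S period1) y0 by rewrite rS; exact: hy0.1.
have [c' _ c'y0] : range (h S' period1) y0 by rewrite rS'; exact: hy0.1.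
rewrite -{1}cy0 -c'y0 !hinvK//.
have cc' : h S period1 c = h S' period1 c' by rewrite cy0 c'y0.
(* The period 2 threshold 0 is an arbitrary reference against which two period 1 thresholds are
   compared. *)
have [u' uu'] := matching period2 0.
split=> [|[] s]; first by have [] := id _ _ _ _ cc' uu'.
  have [s' ss'] := matching period1 (s + c).
  have [_ d1] := id _ _ _ _ cc' uu'; have [_ d2] := id _ _ _ _ ss' uu'.
  by rewrite ss'; congr (h S' _ _); lra.
have [s' ss'] := matching period2 (s + c).
have [_ d1] := id _ _ _ _ cc' ss'.
by rewrite ss'; congr (h S' _ _); lra.
Qed.

(** In both structures the net effects are the same measurable function [rho] of the observables. *)
Lemma net_effects_same_law (S S' : structure R K) (c c' : R) :
  (forall t, {homo h S t : s s' / s < s'}) ->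
  beta S = beta S' -> (forall t s, h S t (s + c) = h S' t (s + c')) ->
  same_observed_law S S' ->
  forall A B, measurable A -> measurable B ->
    law S (Xs @^-1` A `&` net_effects c @^-1` B) =
    law S' (Xs @^-1` A `&` net_effects c' @^-1` B).
Proof.
move=> mS bb' hh' SS' A B mA mB.
have [k2 mk2 k2K] := measurable_left_inverse (mS period2).
have [k1 mk1 k1K] := measurable_left_inverse (mS period1).
pose rho (z : (R * R) * covT R K) :=
  (k2 z.1.2 - c - lin_index (beta S) period2 z.2,
   k1 z.1.1 - c - lin_index (beta S) period1 z.2).
have mrho : measurable_fun setT rho.
  have mx t : measurable_fun setT
      (fun z : (R * R) * covT R K => lin_index (beta S) t z.2).
    exact: (measurableT_comp (measurable_index _ _) (@measurable_snd _ _ _ _)).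
  apply/measurable_fun_pairP; split => /=; apply: measurable_funB => //;
    apply: measurable_funB => //.
    apply: (measurableT_comp mk2).
    exact: (measurableT_comp (@measurable_snd _ _ _ _) (@measurable_fst _ _ _ _)).
  apply: (measurableT_comp mk1).
  exact: (measurableT_comp (@measurable_fst _ _ _ _) (@measurable_fst _ _ _ _)).
have rhoE w : rho (observables S w) = net_effects c w.
  rewrite /rho /observables /outcome /= k1K k2K !XbetaE /net_effects.
  by congr (_, _); ring.
have rhoE' w : rho (observables S' w) = net_effects c' w.
  (* The links of [S'] are shifts of those of [S], so [k1] and [k2] return the latent index of [S']
     plus [c - c']; subtracting [c] leaves it net of [c']. *)
  have shift t x : h S' t x = h S t (x - c' + c) by rewrite hh' subrK.
  rewrite /rho /observables /outcome /= !shift k1K k2K !XbetaE -bb' /net_effects.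
  by congr (_, _); ring.
pose D := [set z | A z.2] `&` rho @^-1` B.
have mD : measurable D.
  apply: measurableI; last by rewrite -[X in measurable X]setTI; exact: mrho.
  by have := @measurable_snd _ _ (R * R)%type (covT R K) measurableT _ mA; rewrite setTI.
have := SS' D mD; congr (_ = _); congr (law _ _); apply/seteqP; split => w;
  by rewrite /D /= ?rhoE ?rhoE'.
Qed.

End identification.

(** * The covariance formula and identification of the variance *)

Theorem theorem5 (R : realType) (K : nat) (Y : set R) (y0 : R)
    (hy0 : lower_trim Y y0) :
  (forall (S : structure R K)
      (P : {mfun (covT R K) >-> pprobability (latT R K) R}),
    admissible Y S P ->
    {ae distribution (law S) Xs, forall x,
      cond_variance_alpha P x =
      covariance (P x) (residual S y0 period2) (residual S y0 period1)}) /\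
  (forall (S S' : structure R K)
      (P P' : {mfun (covT R K) >-> pprobability (latT R K) R}),
    admissible Y S P -> admissible Y S' P' -> same_observed_law S S' ->
    {ae distribution (law S) Xs, forall x,
      cond_variance_alpha P x = cond_variance_alpha P' x}).
Proof.
have var (S : structure R K) P : admissible Y S P ->
    {ae distribution (law S) Xs, forall x,
      cond_variance_alpha P x =
      covariance (P x) (residual S y0 period2) (residual S y0 period1)}.
  move=> aS; have mS := adm_strict aS.
  move: (adm_finite aS) (adm_cov_alpha_U aS) (adm_cov_U aS).
  apply: filterS3 => x [faa fau fuu] cau cuu.
  rewrite !residualE//; apply/esym.
  exact: (covariance_residuals _ faa (fau period1) (fau period2) fuu
    (cau period1) (cau period2) cuu).
split; first exact: var.
move=> S S' P P' aS aS' SS'.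
have [bb' hh'] := links_identified hy0 aS aS' SS'.
have same_dist A : measurable A ->
    distribution (law S') Xs A = distribution (law S) Xs A.
  by move=> mA; rewrite /distribution /pushforward (same_observed_Xs SS').
(* The law of the regressors is common to both structures, so null sets transfer. *)
have var' : {ae distribution (law S) Xs, forall x,
    cond_variance_alpha P' x =
    covariance (P' x) (residual S' y0 period2) (residual S' y0 period1)}.
  have [N [mN N0 sub]] := var _ _ aS'.
  by exists N; split => //; rewrite -same_dist.
(* For almost every [x] the pair of net effects has the same conditional law in both structures. *)
have := cond_law_pair_unique
  (Z := net_effects (hinv S period1 y0)) (Z' := net_effects (hinv S' period1 y0))
  (adm_version aS) (adm_version aS')
  (net_effects_same_law (adm_strict aS) bb' hh' SS').
move: (var _ _ aS) var'; apply: filterS3 => x -> -> /covariance_same_law.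
by rewrite !(residualE _ (adm_strict aS _)) !(residualE _ (adm_strict aS' _)).
Qed.
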